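(* Let $K$ be an algebraically closed field of characteristic $p>0$ with $p\neq 2$, and let $n>3$. Let $\Phi$ be a group automorphism of $\mathrm{Aut}_0 K[x_1,\ldots,x_n]$ which fixes every element of the standard torus $T^n$, i.e. $\Phi(\sigma_\lambda)=\sigma_\lambda$ for every $\lambda=(\lambda_1,\ldots,\lambda_n)\in (K^\times)^n$, where $\sigma_\lambda$ is the automorphism $x_i\mapsto \lambda_i x_i$ ($i=1,\ldots,n$). Then there exists a linear automorphism $S\in \mathrm{GL}_n(K)$ such that the map $\varphi\mapsto S\circ\Phi(\varphi)\circ S^{-1}$ fixes every (origin-preserving) elementary automorphism.
   Context: $\mathrm{Aut}_0 K[x_1,\ldots,x_n]$ denotes the group (under composition) of $K$-algebra automorphisms $\varphi$ of the polynomial algebra $K[x_1,\ldots,x_n]$ that preserve the origin, i.e. each $\varphi(x_i)$ has zero constant term. $\mathrm{GL}_n(K)\subset \mathrm{Aut}_0K[x_1,\ldots,x_n]$ is the subgroup of linear automorphisms $x_i\mapsto \sum_j a_{ij}x_j$ with $(a_{ij})$ invertible. An (origin-preserving) elementary automorphism is one of the form $x_i\mapsto x_i+P(x_1,\ldots,\hat{x}_i,\ldots,x_n)$, $x_k\mapsto x_k$ for $k\neq i$, where $P$ does not depend on $x_i$ and has zero constant term. *)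

(* Defs.v *)
From HB Require Import structures.
From mathcomp Require Import all_boot all_order all_algebra.
From mathcomp Require Import mpoly.
Set Implicit Arguments. Unset Strict Implicit. Unset Printing Implicit Defensive.
Import GRing.Theory.
Local Open Scope ring_scope.

(* A K-algebra endomorphism of K[x_1..x_n] is determined by the images of
   the variables: endo K n := n-tuple (phi(x_1), ..., phi(x_n)). *)
Definition endo (K : fieldType) (n : nat) := n.-tuple {mpoly K[n]}.

(* composition (f o g)(x_i) = f(g(x_i)) = g(x_i)(f(x_1),...,f(x_n)) *)
Definition ecomp (K : fieldType) (n : nat) (f g : endo K n) : endo K n :=
  [tuple comp_mpoly f (tnth g i) | i < n].

Definition eid (K : fieldType) (n : nat) : endo K n := [tuple 'X_i | i < n].

Definition is_aut0 (K : fieldType) (n : nat) (f : endo K n) : Prop :=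
  (exists g : endo K n, ecomp f g = eid K n /\ ecomp g f = eid K n) /\
  (forall i : 'I_n, mcoeff 0%MM (tnth f i) = 0).

(* Phi is a group automorphism of Aut_0 K[x_1..x_n] (values of Phi outside
   Aut_0 are irrelevant). *)
Definition is_group_aut_aut0 (K : fieldType) (n : nat)
    (Phi : endo K n -> endo K n) : Prop :=
  [/\ (forall f, is_aut0 f -> is_aut0 (Phi f)),
      (forall f g, is_aut0 f -> is_aut0 g -> Phi (ecomp f g) = ecomp (Phi f) (Phi g)),
      (forall f g, is_aut0 f -> is_aut0 g -> Phi f = Phi g -> f = g) &
      (forall h, is_aut0 h -> exists2 f, is_aut0 f & Phi f = h)].

Definition torus (K : fieldType) (n : nat) (lam : 'I_n -> K) : endo K n :=
  [tuple lam i *: 'X_i | i < n].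

Definition linaut (K : fieldType) (n : nat) (A : 'M[K]_n) : endo K n :=
  [tuple \sum_(j < n) A i j *: 'X_j | i < n].

Definition elem (K : fieldType) (n : nat) (i : 'I_n) (P : {mpoly K[n]}) : endo K n :=
  [tuple if j == i then 'X_j + P else 'X_j | j < n].

Definition elem_ok (K : fieldType) (n : nat) (i : 'I_n) (P : {mpoly K[n]}) : Prop :=
  (forall m, m \in msupp P -> m i = 0%N) /\ mcoeff 0%MM P = 0.

(* Main.v *)
Require Import Defs.
From HB Require Import structures.
From mathcomp Require Import all_boot all_order all_algebra.
From mathcomp Require Import mpoly.
From mathcomp Require Import ring zify.
Set Implicit Arguments.
Unset Strict Implicit.
Unset Printing Implicit Defensive.
Import GRing.Theory.
Local Open Scope ring_scope.

(* Let [u_(i,m)(c)] be the shear [x_i |-> x_i + c x^m], where [m_i = 0] and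
   [m <> 0]. Its image under Phi commutes with the subtorus [lam^m = lam_i], so
   its [j]-th component only involves [x_j] and one further monomial: [x^m] if
   [j = i], and [x_i] otherwise. Torus conjugation rescales [c], which tells how
   the coefficients depend on [c]; then [u(c) u(c') = u(c + c')] makes the
   coefficients of the [x_j] equal to 1 and kills those of [x_i] for [j <> i].
   Hence Phi maps [u_(i,m)(c)] to [u_(i,m)(b_(i,m) c)].
   Conjugating [u_(i,m + r e_j)] by [u_(j,q)] gives
   [b_(i,m + r q) = b_(i,m + r e_j) * b_(j,q)^r]. The nowhere zero solutions of
   this relation are determined by their values in degrees 1 and 2, and are all
   of the form [b_(i,m) = lam^m / lam_i]. So Phi acts on the elementary
   automorphisms as conjugation by a torus element. *)

Local Notation "m ^[ lam ]" := (mmap1 lam m).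

Section Multinomials.
Variable n : nat.
Implicit Types (i j k : 'I_n) (m a : 'X_{1..n}).

Lemma exists_ord_neq2 i j : (2 < n)%N -> exists2 k, k != i & k != j.
Proof.
move=> n_gt2; have /subsetPn[k _] : ~~ ([set: 'I_n] \subset [set i; j]).
  apply: contraL n_gt2 => /subset_leq_card; rewrite cardsT card_ord -leqNgt.
  by move=> /leq_trans; apply; rewrite cards2; case: (_ != _).
by rewrite !inE negb_or => /andP[ki kj]; exists k.
Qed.

Lemma mnm_neq0P m : reflect (exists k, m k != 0%N) (m != 0%MM).
Proof.
apply: (iffP idP) => [m0|[k]]; last by apply: contraNneq => ->; rewrite mnm0E.
apply/existsP; apply: contraR m0 => /existsPn m0; apply/eqP/mnmP => k.
by rewrite mnm0E; apply/eqP/negPn/m0.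
Qed.

Definition shear_mnm i m := (m i == 0%N) && (m != 0%MM).

Lemma shear_mnmU i k : shear_mnm i U_(k) = (k != i).
Proof. by rewrite /shear_mnm mnm1E mnm1_eq0 andbT eqb0. Qed.

Lemma shear_mnmD i m a : shear_mnm i m -> a i = 0%N -> shear_mnm i (m + a).
Proof.
case/andP=> /eqP mi m0 ai; rewrite /shear_mnm mnmDE mi ai mnmD_eq0.
by rewrite (negPf m0).
Qed.

Lemma shear_mnm_supp i m : shear_mnm i m -> exists2 k, k != i & m k != 0%N.
Proof.
case/andP=> /eqP mi /mnm_neq0P[k mk]; exists k => //.
by apply: contraNneq mk => ->; rewrite mi.
Qed.

Definition offdiag_mnm i m j := if j == i then m else U_(i)%MM.

(* The equations say that [x^a / x_j] is a power of [x^m / x_i], in a form that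
   avoids subtraction. *)
Lemma mnm_diag_or_offdiag i m j a : shear_mnm i m ->
    (forall k, k != i -> a k + m k * a i = (j == k) + m k * (j == i))%N ->
  a = U_(j)%MM \/ a = offdiag_mnm i m j.
Proof.
move=> im aE; have [k ki mk] := shear_mnm_supp im.
have /andP[/eqP mi _] := im; have akE := aE k ki; rewrite /offdiag_mnm.
have [ji|ji] := eqVneq j i.
  case ai: (a i) akE => [|[|r]] akE.
  - right; apply/mnmP => l; have [->|li] := eqVneq l i; first by rewrite ai mi.
    by have := aE l li; rewrite ai ji eqxx eq_sym (negPf li); lia.
  - left; apply/mnmP => l; rewrite mnm1E; have [->|li] := eqVneq l i.
      by rewrite ai ji eqxx.
    by have := aE l li; rewrite ai ji eqxx; lia.
  - by move: akE; rewrite ji eqxx eq_sym (negPf ki); nia.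
have {}aE l : l != i -> (a l + m l * a i = (j == l))%N.
  by move=> li; rewrite aE // (negPf ji) muln0 addn0.
case ai: (a i) => [|r].
  left; apply/mnmP => l; rewrite mnm1E; have [->|li] := eqVneq l i.
    by rewrite ai (negPf ji).
  by have := aE l li; rewrite ai muln0 addn0.
right; have kj : j = k by have := aE k ki; rewrite ai; case: eqP => //; nia.
have := aE k ki; rewrite kj eqxx ai => ak.
apply/mnmP => l; rewrite mnm1E eq_sym; have [->|li] := eqVneq l i.
  by rewrite ai; nia.
have := aE l li; rewrite kj; have [<-|_] := eqVneq k l; last by lia.
by rewrite ai; nia.
Qed.

End Multinomials.

Section MonomialEvaluation.
Variable n : nat.
Implicit Types m q : 'X_{1..n}.

Lemma mmap1D (R : comNzRingType) (lam : 'I_n -> R) m q :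
  (m + q)%MM^[lam] = m^[lam] * q^[lam].
Proof. by apply: commr_mmap1_M => k x; apply: mulrC. Qed.

Lemma mmap1Mn (R : comNzRingType) (lam : 'I_n -> R) m r :
  (m *+ r)%MM^[lam] = m^[lam] ^+ r.
Proof.
by elim: r => [|r IHr]; rewrite ?mulm0n ?mmap11 // mulmS mmap1D IHr exprS.
Qed.

Lemma mmap1_neq0 (R : idomainType) (lam : 'I_n -> R) m :
  (forall k, lam k != 0) -> m^[lam] != 0.
Proof. by move=> lam0; apply/prodf_neq0 => k _; rewrite expf_neq0. Qed.

Lemma mmap1V (K : fieldType) (lam : 'I_n -> K) m :
  m^[fun k => (lam k)^-1] = (m^[lam])^-1.
Proof. by rewrite /mmap1 -prodfV; apply: eq_bigr => k _; rewrite exprVn. Qed.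

End MonomialEvaluation.

Section SubstitutiveWeights.
Variables (K : fieldType) (n : nat).
Implicit Types (i j k : 'I_n) (m q : 'X_{1..n}) (lam : 'I_n -> K).
Implicit Types b : 'I_n -> 'X_{1..n} -> K.

(* The relation satisfied by the factors by which an automorphism of Aut_0
   rescales the shears, read off from the substitution [x_j |-> x_j + x^q] in
   [x^(m + r e_j)]. *)
Definition substitutive b := forall i j m q r,
  i != j -> m j = 0%N -> shear_mnm i (m + U_(j) *+ r) ->
  shear_mnm i q -> shear_mnm j q ->
  b i (m + q *+ r)%MM = b i (m + U_(j) *+ r)%MM * b j q ^+ r.

Definition coboundary lam i m : K := m^[lam] / lam i.

Lemma coboundary_substitutive lam :
  (forall k, lam k != 0) -> substitutive (coboundary lam).
Proof.
move=> lam0 i j m q r _ _ _ _ _; rewrite /coboundary !mmap1D !mmap1Mn mmap1U.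
by rewrite exprMn exprVn; field; rewrite expf_neq0 ?lam0.
Qed.

Section Uniqueness.
Variables b c : 'I_n -> 'X_{1..n} -> K.
Hypothesis n_gt2 : (2 < n)%N.
Hypothesis b_neq0 : forall i m, shear_mnm i m -> b i m != 0.
Hypotheses (b_subst : substitutive b) (c_subst : substitutive c).
Hypothesis eq_lin : forall i k, k != i -> b i U_(k)%MM = c i U_(k)%MM.
Hypothesis eq_sqr :
  forall i k, k != i -> b i (U_(k) + U_(k))%MM = c i (U_(k) + U_(k))%MM.

Lemma substitutive_eq_transfer i j m q r :
    i != j -> m j = 0%N -> shear_mnm i (m + U_(j) *+ r) ->
    shear_mnm i q -> shear_mnm j q -> b j q = c j q ->
  b i (m + q *+ r)%MM = c i (m + q *+ r)%MM <->
  b i (m + U_(j) *+ r)%MM = c i (m + U_(j) *+ r)%MM.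
Proof.
move=> ij mj im iq jq eq_q; rewrite (b_subst ij) // (c_subst ij) // -eq_q.
by split=> [/mulIf->|->] //; rewrite expf_neq0 ?b_neq0.
Qed.

Lemma substitutive_eq_quadratic i j k : j != i -> k != i ->
  b i (U_(k) + U_(j))%MM = c i (U_(k) + U_(j))%MM.
Proof.
move=> ji ki; have [->|jk] := eqVneq j k; first exact: eq_sqr.
have [ij kj] : i != j /\ k != j by split; rewrite eq_sym.
have := @substitutive_eq_transfer i j U_(k)%MM U_(k)%MM 1 ij.
rewrite !mulm1n !shear_mnmU mnm1E (negPf kj) => /(_ erefl _ ki isT (eq_lin kj)).
case=> [|eq_kj _]; last exact/eq_kj/eq_sqr.
by rewrite shear_mnmD ?shear_mnmU // mnm1E (negPf ji).
Qed.

(* With [x_k] dividing [x^m = x_k x^q], the monomial [x^m] arises from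
   [x_k x_j] by substituting [x^q] for the missing variable [x_j]. *)
Lemma substitutive_eq_missing d i j m :
    (forall k q, (mdeg q < d)%N -> shear_mnm k q -> b k q = c k q) ->
    (mdeg m <= d)%N -> j != i -> m j = 0%N -> shear_mnm i m ->
  b i m = c i m.
Proof.
move=> IH le_md ji mj im; have ij : i != j by rewrite eq_sym.
have [k ki mk] := shear_mnm_supp im; have /andP[/eqP mi _] := im.
have jk : k != j by apply: contraNneq mk => ->; rewrite mj.
have : (U_(k) <= m)%MM by rewrite lep1mP.
move/submK; rewrite addmC; set q := (m - U_(k))%MM => mE.
have [q0|q0] := eqVneq q 0%MM; first by rewrite -mE q0 addm0 eq_lin.
have jq : shear_mnm j q by rewrite /shear_mnm q0 andbT mnmBE mj.
have iq : shear_mnm i q by rewrite /shear_mnm q0 andbT mnmBE mi.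
have eq_q : b j q = c j q by apply: IH => //; rewrite -mE mdegD mdeg1 in le_md.
have := @substitutive_eq_transfer i j U_(k)%MM q 1 ij.
rewrite !mulm1n mE mnm1E (negPf jk) => /(_ erefl _ iq jq eq_q) eq_m.
apply/eq_m; last exact: substitutive_eq_quadratic.
by rewrite shear_mnmD ?shear_mnmU // mnm1E (negPf ji).
Qed.

(* When no variable is missing, one of them is first merged into another. *)
Lemma substitutive_eq i m : shear_mnm i m -> b i m = c i m.
Proof.
have [d] := ubnP (mdeg m); elim: d i m => // d IH i m lt_md im.
have [k ki _] := exists_ord_neq2 i i n_gt2.
have [j ji jk] := exists_ord_neq2 i k n_gt2.
have [ij kj] : i != j /\ k != j by split; rewrite eq_sym.
have : (U_(j) *+ m j <= m)%MM.
  apply/mnm_lepP => l; rewrite mulmnE mnm1E.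
  by have [<-|_] := eqVneq j l; rewrite ?mul1n.
move/submK; set a := (m - _)%MM => mE.
have aj : a j = 0%N by rewrite mnmBE mulmnE mnm1E eqxx mul1n subnn.
have /andP[/eqP mi m_neq0] := im.
have := @substitutive_eq_transfer i j a U_(k)%MM (m j) ij aj.
rewrite mE !shear_mnmU => /(_ im ki kj (eq_lin kj)) eq_m.
have mdeg_merged : mdeg (a + U_(k) *+ m j) = mdeg m.
  by rewrite -[in RHS]mE !mdegD !mdegMn !mdeg1.
apply/eq_m/(substitutive_eq_missing (d := d) (j := j)) => //.
- by rewrite mdeg_merged.
- by rewrite mnmDE aj mulmnE mnm1E (negPf kj).
- rewrite /shear_mnm -mdeg_eq0 mdeg_merged mdeg_eq0 m_neq0 andbT.
  by rewrite mnmDE mulmnE mnm1E (negPf ki) mnmBE mi.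
Qed.

End Uniqueness.

Section Existence.
Variable b : 'I_n -> 'X_{1..n} -> K.
Hypothesis n_gt2 : (2 < n)%N.
Hypothesis b_neq0 : forall i m, shear_mnm i m -> b i m != 0.
Hypothesis b_subst : substitutive b.

Lemma substitutive_linear i j q : i != j -> shear_mnm i q -> shear_mnm j q ->
  b i q = b i U_(j)%MM * b j q.
Proof.
move=> ij iq jq; have := @b_subst i j 0%MM q 1 ij.
by rewrite !mulm1n !add0m mnm0E shear_mnmU eq_sym expr1; apply.
Qed.

Let sqr_ratio i k := b i (U_(k) + U_(k))%MM / b i U_(k)%MM.

Let bU_neq0 i k : k != i -> b i U_(k)%MM != 0.
Proof. by move=> ki; rewrite b_neq0 ?shear_mnmU. Qed.

Let shear_sqr i k : k != i -> shear_mnm i (U_(k) + U_(k))%MM.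
Proof. by move=> ki; rewrite shear_mnmD ?shear_mnmU // mnm1E (negPf ki). Qed.

Lemma sqr_ratio_indep i j k : k != i -> k != j -> sqr_ratio i k = sqr_ratio j k.
Proof.
move=> ki kj; have [->//|ij] := eqVneq i j; rewrite /sqr_ratio.
have bik : b i U_(k)%MM = b i U_(j)%MM * b j U_(k)%MM.
  by rewrite -substitutive_linear ?shear_mnmU.
rewrite (substitutive_linear ij) ?shear_sqr // bik.
by field; rewrite !bU_neq0 // eq_sym.
Qed.

Lemma sqr_ratio_linear i j k : i != j -> k != i -> k != j ->
  sqr_ratio j k = sqr_ratio j i * b i U_(k)%MM.
Proof.
move=> ij ki kj; have ji : j != i by rewrite eq_sym.
have := @b_subst j i 0%MM U_(k)%MM 2 ji.
rewrite !add0m mnm0E !mulmS !mulm0n !addm0 shear_sqr ?shear_mnmU //.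
rewrite /sqr_ratio => -> //.
rewrite (substitutive_linear ji (q := U_(k)%MM)) ?shear_mnmU //.
by field; rewrite !bU_neq0.
Qed.

Lemma substitutive_coboundary :
  exists2 lam : 'I_n -> K, (forall k, lam k != 0) &
    forall i m, shear_mnm i m -> b i m = coboundary lam i m.
Proof.
have /fin_all_exists[o oP] k : exists i, k != i.
  by have [i ik _] := exists_ord_neq2 k k n_gt2; exists i; rewrite eq_sym.
pose lam k := sqr_ratio (o k) k.
have lam_neq0 k : lam k != 0.
  by rewrite mulf_neq0 ?invr_eq0 ?bU_neq0 ?b_neq0 ?shear_sqr.
have lamE i k : k != i -> lam k = sqr_ratio i k.
  by move=> ki; apply: sqr_ratio_indep.
have b_lin i k : k != i -> b i U_(k)%MM = lam k / lam i.
  move=> ki; have [j ji jk] := exists_ord_neq2 i k n_gt2.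
  have [ij kj] : i != j /\ k != j by split; rewrite eq_sym.
  rewrite (lamE j k) // (sqr_ratio_linear ij) // -(lamE j i) //.
  by rewrite mulrC mulKf.
exists lam => //; apply: substitutive_eq => //.
- exact: coboundary_substitutive.
- by move=> i k ki; rewrite b_lin // /coboundary mmap1U.
- move=> i k ki; rewrite /coboundary mmap1D !mmap1U -mulrA -b_lin //.
  by rewrite (lamE i) // divfK ?bU_neq0.
Qed.

End Existence.
End SubstitutiveWeights.

Section Reweight.
Variables (R : nzRingType) (n : nat).
Implicit Types (w : 'X_{1..n} -> R) (P Q : {mpoly R[n]}) (m a : 'X_{1..n}).

Definition reweight w P : {mpoly R[n]} :=
  \sum_(m <- msupp P) (P@_m * w m) *: 'X_[m].

Lemma mcoeff_reweight w P a : (reweight w P)@_a = P@_a * w a.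
Proof.
rewrite [in RHS](mpolyE P) !raddf_sum /= mulr_suml; apply: eq_bigr => m _.
rewrite !mcoeffZ mcoeffX.
by have [->|_] := eqVneq m a; rewrite ?mulr1 ?mulr0 ?mul0r.
Qed.

Lemma reweight0 w : reweight w 0 = 0.
Proof. by rewrite /reweight msupp0 big_nil. Qed.

Lemma reweightD w : {morph reweight w : P Q / P + Q}.
Proof.
by move=> P Q; apply/mpolyP => a; rewrite !(mcoeffD, mcoeff_reweight) mulrDl.
Qed.

Lemma reweightZ w : scalable (reweight w).
Proof.
by move=> c P; apply/mpolyP => a; rewrite !(mcoeffZ, mcoeff_reweight) mulrA.
Qed.

Lemma reweightX w m : reweight w 'X_[m] = w m *: 'X_[m].
Proof. by rewrite /reweight msuppX big_seq1 mcoeffX eqxx mul1r. Qed.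

End Reweight.

Section Endomorphisms.
Variables (K : fieldType) (n : nat).
Implicit Types (f g h : endo K n) (i j k : 'I_n) (m q a : 'X_{1..n}).
Implicit Types (lam mu : 'I_n -> K) (P Q : {mpoly K[n]}).

Lemma tnth_ecomp f g j : tnth (ecomp f g) j = tnth g j \mPo f.
Proof. by rewrite tnth_mktuple. Qed.

Lemma tnth_eid j : tnth (eid K n) j = 'X_j.
Proof. by rewrite tnth_mktuple. Qed.

Lemma tnth_torus lam j : tnth (torus lam) j = lam j *: 'X_j.
Proof. by rewrite tnth_mktuple. Qed.

Lemma tnth_elem i P j : tnth (elem i P) j = if j == i then 'X_j + P else 'X_j.
Proof. by rewrite tnth_mktuple. Qed.

Definition shear i m (c : K) : endo K n := elem i (c *: 'X_[m]).

Definition tnth_endo := (tnth_ecomp, tnth_eid, tnth_torus, tnth_elem).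

Lemma comp_mpolyXtnth f i : 'X_i \mPo f = tnth f i.
Proof. by rewrite comp_mpolyXU -tnth_nth. Qed.

Lemma comp_mpoly_ecomp f g P : P \mPo ecomp f g = (P \mPo g) \mPo f.
Proof.
rewrite comp_mpolyEX [P \mPo g]comp_mpolyEX raddf_sum; apply: eq_bigr => m _.
rewrite /= comp_mpolyZ !comp_mpolyX rmorph_prod; congr (_ *: _).
by apply: eq_bigr => k _; rewrite rmorphXn tnth_ecomp.
Qed.

Lemma ecompA f g h : ecomp f (ecomp g h) = ecomp (ecomp f g) h.
Proof. by apply: eq_from_tnth => j; rewrite !tnth_ecomp comp_mpoly_ecomp. Qed.

Lemma ecompf1 f : ecomp f (eid K n) = f.
Proof.
by apply: eq_from_tnth => j; rewrite tnth_ecomp tnth_eid comp_mpolyXtnth.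
Qed.

Lemma mcoeff0_comp f P : P@_0%MM = 0 -> (forall k, (tnth f k)@_0%MM = 0) ->
  (P \mPo f)@_0%MM = 0.
Proof.
move=> P0 f0; rewrite comp_mpolyEX raddf_sum big1_seq //= => m mP.
have /mnm_neq0P[k mk] : m != 0%MM.
  by apply: contraTneq mP => ->; rewrite mcoeff_msupp P0 eqxx.
rewrite mcoeffZ comp_mpolyX (bigD1 k) //= rmorphM rmorphXn /= f0.
by rewrite expr0n (negPf mk) mul0r mulr0.
Qed.

Lemma comp_mpoly_torus lam P : P \mPo torus lam = reweight (mmap1 lam) P.
Proof.
rewrite comp_mpolyEX; apply: eq_bigr => m _; rewrite comp_mpolyX.
under eq_bigr do rewrite tnth_torus exprZn.
by rewrite scaler_prod -mpolyXE_id scalerA.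
Qed.

Lemma torus1 : torus (fun=> 1) = eid K n.
Proof. by apply: eq_from_tnth => j; rewrite !tnth_endo scale1r. Qed.

Lemma ecomp_torus_eid lam mu : (forall k, lam k * mu k = 1) ->
  ecomp (torus lam) (torus mu) = eid K n.
Proof.
move=> lam_mu; apply: eq_from_tnth => j; rewrite !tnth_endo comp_mpolyZ.
by rewrite comp_mpolyXtnth tnth_torus scalerA mulrC lam_mu scale1r.
Qed.

Definition mpoly_off i P := forall m, m \in msupp P -> m i = 0%N.

Lemma mpoly_offX i m : m i = 0%N -> mpoly_off i 'X_[m].
Proof. by move=> mi a; rewrite msuppX inE => /eqP->. Qed.

Lemma eq_comp_mpoly_off i P f g : mpoly_off i P ->
  (forall k, k != i -> tnth f k = tnth g k) -> P \mPo f = P \mPo g.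
Proof.
move=> Pi eq_fg; rewrite !comp_mpolyEX; apply: eq_big_seq => m /Pi mi.
rewrite !comp_mpolyX; congr (_ *: _); apply: eq_bigr => k _.
by have [->|/eq_fg->//] := eqVneq k i; rewrite mi.
Qed.

Lemma comp_elem_off i P Q : mpoly_off i P -> P \mPo elem i Q = P.
Proof.
move=> Pi; rewrite -[RHS]comp_mpoly_id; apply: eq_comp_mpoly_off Pi _ => k ki.
by rewrite tnth_elem (negPf ki) tnth_mktuple.
Qed.

Lemma elem0 i : elem i 0 = eid K n.
Proof. by apply: eq_from_tnth => j; rewrite !tnth_endo addr0 if_same. Qed.

Lemma elem_inj i : injective (@elem K n i).
Proof.
by move=> P Q /(congr1 (fun f => tnth f i)); rewrite !tnth_elem eqxx => /addrI.
Qed.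

Lemma elem_okP i P :
  elem_ok i P <-> forall m, ~~ shear_mnm i m -> P@_m = 0.
Proof.
split=> [[Pi P0] m|Pi].
  rewrite negb_and negbK => /orP[mi|/eqP->//].
  by apply: contraNeq mi; rewrite -mcoeff_msupp => /Pi->.
split=> [m|]; last by rewrite Pi // /shear_mnm eqxx andbF.
rewrite mcoeff_msupp; apply: contraNeq => mi.
by rewrite Pi // /shear_mnm (negPf mi).
Qed.

Lemma elem_okX i c m : shear_mnm i m -> elem_ok i (c *: 'X_[m] : {mpoly K[n]}).
Proof.
move=> im; apply/elem_okP => a; rewrite mcoeffZ mcoeffX.
by have [<-|_] := eqVneq m a; rewrite ?im ?mulr0.
Qed.

Lemma elem_okN i P : elem_ok i P -> elem_ok i (- P).
Proof.
by move/elem_okP=> Pi; apply/elem_okP => m im; rewrite mcoeffN Pi ?oppr0.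
Qed.

Lemma elem_ok_reweight i w P : elem_ok i P -> elem_ok i (reweight w P).
Proof.
move/elem_okP=> Pi; apply/elem_okP => m im.
by rewrite mcoeff_reweight Pi ?mul0r.
Qed.

(* [P] is free of [x_i] iff it is fixed by [x_i |-> 0], which is the torus
   element [kill] with a zero coordinate. *)
Lemma elem_ok_comp_elem i j P Q : i != j ->
  elem_ok i P -> elem_ok i Q -> elem_ok i (P \mPo elem j Q).
Proof.
move=> ij [Pi P0] [Qi Q0]; apply/elem_okP => m.
rewrite negb_and negbK => /orP[mi|/eqP->]; last first.
  apply: mcoeff0_comp => // k; rewrite tnth_elem.
  by case: ifP => _; rewrite ?mcoeffD ?Q0 mcoeffX mnm1_eq0 ?addr0.
pose kill : endo K n := torus (fun k => (k != i)%:R).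
have killX k : k != i -> tnth kill k = 'X_k.
  by move=> ki; rewrite tnth_torus ki scale1r.
have <- : (P \mPo elem j Q) \mPo kill = P \mPo elem j Q.
  rewrite -comp_mpoly_ecomp; apply: eq_comp_mpoly_off Pi _ => k ki.
  have Qkill : Q \mPo kill = Q.
    rewrite -[RHS]comp_mpoly_id; apply: eq_comp_mpoly_off Qi _ => l li.
    by rewrite killX // tnth_mktuple.
  rewrite tnth_ecomp tnth_elem; case: ifP => _.
    by rewrite comp_mpolyD comp_mpolyXtnth killX ?Qkill.
  by rewrite comp_mpolyXtnth killX.
rewrite comp_mpoly_torus mcoeff_reweight /mmap1 (bigD1 i) //= eqxx.
by rewrite expr0n (negPf mi) mul0r mulr0.
Qed.

Lemma ecomp_elem i P Q : elem_ok i Q ->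
  ecomp (elem i P) (elem i Q) = elem i (P + Q).
Proof.
case=> Qi _; apply: eq_from_tnth => j; rewrite tnth_ecomp !tnth_elem.
have [->|ji] := eqVneq j i; last first.
  by rewrite comp_mpolyXtnth tnth_elem (negPf ji).
by rewrite comp_mpolyD comp_mpolyXtnth tnth_elem eqxx comp_elem_off // addrA.
Qed.

Lemma shearD i m c d : shear_mnm i m ->
  ecomp (shear i m c) (shear i m d) = shear i m (c + d).
Proof.
by move=> im; rewrite /shear ecomp_elem -?scalerDl //; apply: elem_okX.
Qed.

Lemma elem_conj i j P Q : i != j -> elem_ok i Q ->
  ecomp (elem j Q) (elem i P) = ecomp (elem i (P \mPo elem j Q)) (elem j Q).
Proof.
move=> ij [Qi _]; apply: eq_from_tnth => k; rewrite !tnth_ecomp !tnth_elem.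
have [->|ki] := eqVneq k i.
  by rewrite comp_mpolyD (negPf ij) !comp_mpolyXtnth !tnth_elem eqxx (negPf ij).
have [->|kj] := eqVneq k j.
  rewrite comp_mpolyD !comp_mpolyXtnth !tnth_elem eqxx eq_sym (negPf ij).
  by rewrite comp_elem_off.
by rewrite !comp_mpolyXtnth !tnth_elem (negPf ki) (negPf kj).
Qed.

Lemma torus_elem lam i P : lam i != 0 ->
  ecomp (torus lam) (elem i P) =
  ecomp (elem i ((lam i)^-1 *: (P \mPo torus lam))) (torus lam).
Proof.
move=> li; apply: eq_from_tnth => j; rewrite !tnth_ecomp tnth_torus.
rewrite comp_mpolyZ comp_mpolyXtnth !tnth_elem.
have [->|_] := eqVneq j i; last by rewrite comp_mpolyXtnth tnth_torus.
rewrite comp_mpolyD comp_mpolyXtnth tnth_torus scalerDr scalerA divff //.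
by rewrite scale1r.
Qed.

Lemma torus_shear lam i m c : lam i != 0 ->
  ecomp (torus lam) (shear i m c) =
  ecomp (shear i m (c * m^[lam] / lam i)) (torus lam).
Proof.
move=> li; rewrite torus_elem // comp_mpolyZ comp_mpoly_torus.
by rewrite reweightX !scalerA -mulrA [_^-1 * _]mulrC.
Qed.

Lemma is_aut0_torus lam : (forall k, lam k != 0) -> is_aut0 (torus lam).
Proof.
move=> lam0; split=> [|j]; last first.
  by rewrite tnth_torus mcoeffZ mcoeffX mnm1_eq0 mulr0.
exists (torus (fun k => (lam k)^-1)).
by split; apply: ecomp_torus_eid => k; rewrite ?mulVf ?mulfV.
Qed.

Lemma is_aut0_elem i P : elem_ok i P -> is_aut0 (elem i P).
Proof.
move=> Pok; split=> [|j].
  exists (elem i (- P)); rewrite !ecomp_elem ?addrN ?addNr ?elem0 //.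
  exact: elem_okN.
rewrite tnth_elem; case: ifP => _; rewrite ?mcoeffD mcoeffX mnm1_eq0 //.
by rewrite Pok.2 addr0.
Qed.

Lemma is_aut0_shear i m c : shear_mnm i m -> is_aut0 (shear i m c).
Proof. by move=> im; apply/is_aut0_elem/elem_okX. Qed.

Lemma mcoeff_comp_elemX j m q r (c : K) : q j = 0%N -> m j = 0%N ->
  ('X_[m + U_(j) *+ r] \mPo elem j (c *: 'X_[q]))@_(m + q *+ r) = c ^+ r.
Proof.
move=> qj mj; rewrite mpolyXD rmorphM /= (comp_elem_off _ (mpoly_offX mj)).
rewrite mulrC mcoeffMX -mpolyXn rmorphXn /= comp_mpolyXtnth tnth_elem eqxx.
rewrite exprDn raddf_sum (bigD1 ord_max) //= big1 => [|k].
  rewrite subnn expr0 mul1r binn mulr1n addr0 exprZn mpolyXn mcoeffZ mcoeffX.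
  by rewrite eqxx mulr1.
rewrite -val_eqE /= => kr; rewrite mcoeffMn exprZn !mpolyXn -scalerAr -mpolyXD.
rewrite mcoeffZ mcoeffX; case: eqP => [/mnmP/(_ j)|_]; last first.
  by rewrite mulr0 mul0rn.
rewrite mnmDE !mulmnE mnm1E eqxx qj.
have := ltn_ord k; lia.
Qed.

End Endomorphisms.

Definition infinite_field (K : fieldType) :=
  forall p : {poly K}, p != 0 -> exists x, ~~ root p x.

Section InfiniteField.
Variable K : fieldType.
Hypothesis K_infinite : infinite_field K.

Lemma exists_nonroot_notin (s : seq K) (p : {poly K}) :
  p != 0 -> exists2 x, x \notin s & ~~ root p x.
Proof.
move=> p0; have /K_infinite[x] : (\prod_(y <- s) ('X - y%:P)) * p != 0.
  by rewrite mulf_neq0 // monic_neq0 ?monic_prod_XsubC.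
by rewrite rootM root_prod_XsubC negb_or => /andP[]; exists x.
Qed.

Lemma expr_fun_inj (a b : nat) :
  (forall t : K, t != 0 -> t ^+ a = t ^+ b) -> a = b.
Proof.
move=> eq_ab; apply/eqP; apply: contraT => neq_ab.
have /(exists_nonroot_notin [:: 0])[t] : 'X^a - 'X^b != 0 :> {poly K}.
  rewrite subr_eq0; apply: contra neq_ab => /eqP eqX.
  by rewrite -eqSS -(size_polyXn K a) -(size_polyXn K b) eqX.
by rewrite inE /root !hornerE => t0; rewrite eq_ab // subrr eqxx.
Qed.

End InfiniteField.

Section TorusFixing.
Variables (K : fieldType) (n : nat) (Phi : endo K n -> endo K n).
Implicit Types (i j k : 'I_n) (m q a : 'X_{1..n}) (lam : 'I_n -> K).
Implicit Types (c s t : K) (P Q : {mpoly K[n]}).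
Hypothesis K_infinite : infinite_field K.
Hypothesis Phi_aut : is_group_aut_aut0 Phi.
Hypothesis Phi_torus : forall lam, (forall k, lam k != 0) ->
  Phi (torus lam) = torus lam.

Lemma Phi_eid : Phi (eid K n) = eid K n.
Proof. by rewrite -torus1 Phi_torus // => k; rewrite oner_neq0. Qed.

Lemma Phi_ecomp f g : is_aut0 f -> is_aut0 g ->
  Phi (ecomp f g) = ecomp (Phi f) (Phi g).
Proof. by case: Phi_aut => _ + _ _; apply. Qed.

Lemma Phi_shear0 i m : Phi (shear i m 0) = eid K n.
Proof. by rewrite /shear scale0r elem0 Phi_eid. Qed.

Lemma Phi_shearD i m c s : shear_mnm i m ->
  ecomp (Phi (shear i m c)) (Phi (shear i m s)) = Phi (shear i m (c + s)).
Proof.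
by move=> im; rewrite -Phi_ecomp ?shearD //; apply: is_aut0_shear.
Qed.

Lemma mcoeff_Phi_shear_torus lam i m c j a :
    shear_mnm i m -> (forall k, lam k != 0) ->
  a^[lam] * (tnth (Phi (shear i m c)) j)@_a =
  lam j * (tnth (Phi (shear i m (c * m^[lam] / lam i))) j)@_a.
Proof.
move=> im lam0; have aut_sh s := is_aut0_shear s im.
have aut_lam := is_aut0_torus lam0.
have /(congr1 (fun f => (tnth (Phi f) j)@_a)) := torus_shear m c (lam0 i).
rewrite (Phi_ecomp aut_lam (aut_sh _)) (Phi_ecomp (aut_sh _) aut_lam).
rewrite (Phi_torus lam0) !tnth_ecomp comp_mpoly_torus mcoeff_reweight mulrC.
by rewrite tnth_torus comp_mpolyZ comp_mpolyXtnth mcoeffZ.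
Qed.

Lemma mcoeff_Phi_shear_subtorus i k m c s t j a :
    k != i -> shear_mnm i m -> s != 0 -> t != 0 ->
  t ^+ a k * s ^+ a i * (tnth (Phi (shear i m c)) j)@_a =
  t ^+ (j == k) * s ^+ (j == i) *
    (tnth (Phi (shear i m (c * t ^+ m k / s))) j)@_a.
Proof.
move=> ki im s0 t0; have ik : i != k by rewrite eq_sym.
pose lam l := t ^+ (l == k) * s ^+ (l == i).
have lam0 l : lam l != 0 by rewrite mulf_neq0 ?expf_neq0.
have lamE q : q^[lam] = t ^+ q k * s ^+ q i.
  rewrite /mmap1 (bigD1 k) //= (bigD1 i) 1?eq_sym //= big1 => [|l].
    by rewrite /lam !eqxx (negPf ki) (negPf ik) !mulr1 mul1r.
  by case/andP=> lk li; rewrite /lam (negPf lk) (negPf li) mulr1 expr1n.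
have /andP[/eqP mi _] := im; have := mcoeff_Phi_shear_torus c j a im lam0.
by rewrite !lamE mi mulr1 /lam eqxx (negPf ik) mul1r.
Qed.

(* The subtorus [lam_k = t], [lam_i = t ^ m_k] commutes with the shear. *)
Lemma mcoeff_Phi_shear_supp i m c j a : shear_mnm i m ->
    (tnth (Phi (shear i m c)) j)@_a != 0 ->
  a = U_(j)%MM \/ a = offdiag_mnm i m j.
Proof.
move=> im ga0; apply: (mnm_diag_or_offdiag im) => k ki.
apply: (expr_fun_inj K_infinite) => t t0.
have t_mk : t ^+ m k != 0 by rewrite expf_neq0.
have := mcoeff_Phi_shear_subtorus c j a ki im t_mk t0.
by rewrite mulfK // -!exprM -!exprD => /(mulIf ga0).
Qed.

Lemma mcoeff_Phi_shear_scale i m c j a : shear_mnm i m -> c != 0 ->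
  (tnth (Phi (shear i m c)) j)@_a =
  c ^+ (j == i) / c ^+ a i * (tnth (Phi (shear i m 1)) j)@_a.
Proof.
move=> im c0; have [k ki _] := shear_mnm_supp im.
have ci0 : c^-1 != 0 by rewrite invr_eq0.
have := mcoeff_Phi_shear_subtorus 1 j a ki im ci0 (oner_neq0 K).
rewrite !expr1n !mul1r invrK !exprVn -mulrA => ->.
by rewrite mulVKf // expf_neq0.
Qed.

Definition Phi_diag i m j := (tnth (Phi (shear i m 1)) j)@_U_(j).

Definition Phi_offdiag i m j :=
  (tnth (Phi (shear i m 1)) j)@_(offdiag_mnm i m j).

Definition shear_weight i m := Phi_offdiag i m i.

Lemma offdiag_mnm_neqU i m j :
  shear_mnm i m -> offdiag_mnm i m j != U_(j)%MM.
Proof.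
rewrite /offdiag_mnm; have [->|ji] := eqVneq j i; last first.
  by rewrite eq_mnm1 eq_sym.
by apply: contraTneq => ->; rewrite shear_mnmU eqxx.
Qed.

Lemma tnth_Phi_shear i m c j : shear_mnm i m -> c != 0 ->
  tnth (Phi (shear i m c)) j = Phi_diag i m j *: 'X_j +
    ((if j == i then c else c^-1) * Phi_offdiag i m j) *:
      'X_[offdiag_mnm i m j].
Proof.
move=> im c0; apply/mpolyP => a; rewrite mcoeffD !mcoeffZ !mcoeffX.
have exp_neqU := offdiag_mnm_neqU j im; have /andP[/eqP mi _] := im.
have [aj|aj] := eqVneq U_(j)%MM a.
  rewrite -aj (negPf exp_neqU) mulr0 addr0 mulr1 mcoeff_Phi_shear_scale //.
  by rewrite mnm1E divff ?mul1r // expf_neq0.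
have [ae|ae] := eqVneq (offdiag_mnm i m j) a.
  rewrite mulr0 add0r mulr1 -ae mcoeff_Phi_shear_scale //; congr (_ * _).
  rewrite /offdiag_mnm; case: ifP => _; first by rewrite mi divr1.
  by rewrite mnm1E eqxx mul1r.
rewrite !mulr0 addr0; apply/eqP; apply: contraT.
case/(mcoeff_Phi_shear_supp im) => e.
  by rewrite e eqxx in aj.
by rewrite e eqxx in ae.
Qed.

Lemma Phi_offdiag_relation i m j t :
    shear_mnm i m -> j != i -> t != 0 -> t + 1 != 0 ->
  Phi_offdiag i m j * (Phi_diag i m j / t + Phi_diag i m i - (t + 1)^-1) = 0.
Proof.
move=> im ji t0 t1.
have mU : (m == U_(i)%MM) = false.
  by apply: contraTF im => /eqP->; rewrite shear_mnmU eqxx.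
have := Phi_shearD t 1 im => /(congr1 (fun f => (tnth f j)@_U_(i))).
rewrite tnth_ecomp !(tnth_Phi_shear j) ?oner_neq0 // /offdiag_mnm (negPf ji).
rewrite comp_mpolyD !comp_mpolyZ !comp_mpolyXtnth !tnth_Phi_shear //.
rewrite /offdiag_mnm eqxx (negPf ji) !(mcoeffD, mcoeffZ) !mcoeffX !eqxx.
rewrite eq_mnm1 (negPf ji) mU !mulr0 !mulr1 add0r addr0 invr1 mul1r => eq_e.
rewrite mulrBr [_ * _^-1 in X in _ - X]mulrC -[X in _ - X]add0r -eq_e.
by ring.
Qed.

(* The relation says that [(d_j + d_i t) (t + 1) - t] vanishes for [t <> 0, -1];
   but this polynomial is nonzero, being 1 at [t = -1]. *)
Lemma Phi_offdiag_eq0 i m j : shear_mnm i m -> j != i -> Phi_offdiag i m j = 0.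
Proof.
move=> im ji; pose d := Phi_diag i m.
pose p := ((d j)%:P + d i *: 'X) * ('X + 1%:P) - 'X.
have p0 : p != 0.
  apply/eqP => /(congr1 (horner^~ (-1))).
  rewrite !hornerE addNr mulr0 sub0r opprK => /eqP.
  by rewrite oner_eq0.
have [t] := exists_nonroot_notin K_infinite [:: 0; -1] p0.
rewrite !inE negb_or -addr_eq0 => /andP[t0 t1] pt.
have /eqP := Phi_offdiag_relation im ji t0 t1.
rewrite mulf_eq0 => /orP[/eqP//|/eqP rel0]; case/negP: pt; apply/eqP.
rewrite !hornerE.
have -> : (d j + d i * t) * (t + 1) - t =
    t * (t + 1) * (d j / t + d i - (t + 1)^-1) by field; rewrite t0 t1.
by rewrite rel0 mulr0.
Qed.

Lemma tnth_Phi_shear_diag i m c j : shear_mnm i m -> c != 0 ->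
  tnth (Phi (shear i m c)) j = Phi_diag i m j *: 'X_j +
    (if j == i then c * shear_weight i m else 0) *: 'X_[m].
Proof.
move=> im c0; rewrite tnth_Phi_shear // /offdiag_mnm /shear_weight.
have [->//|ji] := eqVneq j i.
by rewrite Phi_offdiag_eq0 // mulr0 !scale0r.
Qed.

Lemma mcoeff_Phi_shear_ecomp i m c s j : shear_mnm i m -> c != 0 -> s != 0 ->
  (tnth (ecomp (Phi (shear i m c)) (Phi (shear i m s))) j)@_U_(j) =
  Phi_diag i m j ^+ 2.
Proof.
move=> im c0 s0.
have cross x : (if j == i then x else 0) * (m == U_(j)%MM)%:R = 0 :> K.
  have [->|_] := eqVneq j i; last by rewrite mul0r.
  case: eqP im => [->|_ _]; last by rewrite mulr0.
  by rewrite shear_mnmU eqxx.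
have Xm_comp : 'X_[m] \mPo Phi (shear i m c) = m^[Phi_diag i m] *: 'X_[m].
  rewrite -reweightX -comp_mpoly_torus; have /andP[/eqP mi _] := im.
  apply: eq_comp_mpoly_off (mpoly_offX mi) _ => k ki.
  by rewrite tnth_Phi_shear_diag // (negPf ki) scale0r addr0 tnth_torus.
rewrite tnth_ecomp (tnth_Phi_shear_diag _ im s0) comp_mpolyD !comp_mpolyZ.
rewrite Xm_comp comp_mpolyXtnth tnth_Phi_shear_diag //.
by rewrite !(mcoeffD, mcoeffZ) !mcoeffX eqxx mulrCA !cross mulr0 !addr0 mulr1.
Qed.

(* The composite with parameters [t] and [1] gives [d_j ^ 2 = d_j], and the one
   with parameters [1] and [-1] gives [d_j ^ 2 = 1]. *)
Lemma Phi_diag_eq1 i m j : shear_mnm i m -> Phi_diag i m j = 1.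
Proof.
move=> im.
have [t] := exists_nonroot_notin K_infinite [:: 0; -1] (oner_neq0 {poly K}).
rewrite !inE negb_or -addr_eq0 => /andP[t0 t1] _.
have d_idem : Phi_diag i m j ^+ 2 = Phi_diag i m j.
  rewrite -(mcoeff_Phi_shear_ecomp j im t0 (oner_neq0 K)) Phi_shearD //.
  by rewrite mcoeff_Phi_shear_scale // mnm1E divff ?mul1r ?expf_neq0.
have N1 : -1 != 0 :> K by rewrite oppr_eq0 oner_neq0.
rewrite -d_idem -(mcoeff_Phi_shear_ecomp j im (oner_neq0 K) N1) Phi_shearD //.
by rewrite subrr Phi_shear0 tnth_eid mcoeffX eqxx.
Qed.

Lemma Phi_shear i m c : shear_mnm i m ->
  Phi (shear i m c) = shear i m (c * shear_weight i m).
Proof.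
move=> im; have [->|c0] := eqVneq c 0.
  by rewrite mul0r Phi_shear0 /shear scale0r elem0.
apply: eq_from_tnth => j; rewrite tnth_Phi_shear_diag // Phi_diag_eq1 //.
by rewrite scale1r tnth_elem; case: ifP => _; rewrite ?scale0r ?addr0.
Qed.

Lemma shear_weight_neq0 i m : shear_mnm i m -> shear_weight i m != 0.
Proof.
move=> im; apply/eqP => w0; case: Phi_aut => _ _ Phi_inj _.
have /(Phi_inj _ _ (is_aut0_shear _ im) (is_aut0_shear _ im)) :
    Phi (shear i m 1) = Phi (shear i m 0) by rewrite !Phi_shear // w0 !mulr0.
move/elem_inj/(congr1 (mcoeff m)); rewrite !mcoeffZ mcoeffX eqxx !mulr1.
by move/eqP; rewrite oner_eq0.
Qed.

Lemma Phi_elem i P : elem_ok i P ->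
  Phi (elem i P) = elem i (reweight (shear_weight i) P).
Proof.
elim/mpolyind: P => [|c m P mP c0 IHP] /elem_okP Pok.
  by rewrite reweight0 elem0 Phi_eid.
have im : shear_mnm i m.
  apply: contraNT c0 => /Pok; rewrite mcoeffD mcoeffZ mcoeffX eqxx mulr1.
  by rewrite (memN_msupp_eq0 mP) addr0 => ->.
have {}Pok : elem_ok i P.
  apply/elem_okP => a ia; have := Pok a ia; rewrite mcoeffD mcoeffZ mcoeffX.
  by have [ma|_] := eqVneq m a; [rewrite -ma im in ia | rewrite mulr0 add0r].
rewrite -ecomp_elem // Phi_ecomp ?IHP //; last 2 first.
- exact: is_aut0_shear.
- exact: is_aut0_elem.
rewrite -/(shear i m c) Phi_shear // ecomp_elem; last exact: elem_ok_reweight.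
by rewrite reweightD reweightZ reweightX scalerA.
Qed.

Lemma reweight_comp_elem i j P Q : i != j ->
    elem_ok i P -> elem_ok i Q -> elem_ok j Q ->
  reweight (shear_weight i) (P \mPo elem j Q) =
  reweight (shear_weight i) P \mPo elem j (reweight (shear_weight j) Q).
Proof.
move=> ij iP iQ jQ; have iPQ := elem_ok_comp_elem ij iP iQ.
have [autP autQ] := (is_aut0_elem iP, is_aut0_elem jQ).
have /(congr1 Phi) := elem_conj P ij iQ.
rewrite (Phi_ecomp autQ autP) (Phi_ecomp (is_aut0_elem iPQ) autQ).
rewrite (Phi_elem iP) (Phi_elem jQ) (Phi_elem iPQ).
rewrite (elem_conj _ ij (elem_ok_reweight _ iQ)).
move/(congr1 (fun f => tnth f i)); rewrite !tnth_ecomp !tnth_elem (negPf ij).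
by rewrite !comp_mpolyXtnth !tnth_elem eqxx => /addrI.
Qed.

Lemma shear_weight_substitutive : substitutive shear_weight.
Proof.
move=> i j m q r ij mj im iq jq; have /andP[/eqP qj _] := jq.
have ok1 l a := @elem_okX K n l 1 a.
have := reweight_comp_elem ij (ok1 i _ im) (ok1 i _ iq) (ok1 j _ jq).
rewrite comp_mpolyZ !reweightZ !reweightX !comp_mpolyZ.
rewrite [1 *: (_ *: 'X_[q])]scalerA.
move/(congr1 (mcoeff (m + q *+ r)%MM)).
by rewrite !mcoeffZ mcoeff_reweight !mcoeff_comp_elemX // expr1n !mul1r.
Qed.

Lemma Phi_elem_torus_conj : (2 < n)%N ->
  exists2 lam : 'I_n -> K, (forall k, lam k != 0) & forall i P, elem_ok i P ->
    ecomp (ecomp (torus lam) (Phi (elem i P))) (torus (fun k => (lam k)^-1)) =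
    elem i P.
Proof.
move=> n_gt2; have [mu mu0 wE] :=
  substitutive_coboundary n_gt2 shear_weight_neq0 shear_weight_substitutive.
exists (fun k => (mu k)^-1) => [k|i P Pok]; first by rewrite invr_eq0.
rewrite Phi_elem // torus_elem ?invr_eq0 // -ecompA ecomp_torus_eid => [|k].
  rewrite ecompf1; congr elem; apply/mpolyP => m.
  rewrite mcoeffZ comp_mpoly_torus !mcoeff_reweight mmap1V invrK.
  have [im|/((elem_okP _ _).1 Pok)->] := boolP (shear_mnm i m); last first.
    by rewrite !mul0r mulr0.
  by rewrite wE // /coboundary; field; rewrite mu0 mmap1_neq0.
by rewrite mulfV ?invr_eq0.
Qed.

End TorusFixing.

Section Diagonal.
Variables (K : fieldType) (n : nat).
Implicit Types lam : 'I_n -> K.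

Lemma linaut_diag lam : linaut (diag_mx (\row_k lam k)) = torus lam.
Proof.
apply: eq_from_tnth => i; rewrite tnth_torus tnth_mktuple (bigD1 i) //=.
rewrite big1 => [|j ji]; first by rewrite !mxE eqxx mulr1n addr0.
by rewrite !mxE eq_sym (negPf ji) scale0r.
Qed.

Lemma diag_mx_unit lam :
  (forall k, lam k != 0) -> diag_mx (\row_k lam k) \in unitmx.
Proof.
move=> lam0; rewrite unitmxE det_diag unitfE.
by apply/prodf_neq0 => k _; rewrite mxE.
Qed.

Lemma invmx_diag lam : (forall k, lam k != 0) ->
  invmx (diag_mx (\row_k lam k)) = diag_mx (\row_k (lam k)^-1).
Proof.
move=> lam0; have lam_unit := diag_mx_unit lam0.
apply: (can_inj (mulKmx lam_unit)); rewrite mulmxV // mulmx_diag.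
by apply/matrixP => k l; rewrite !mxE mulfV.
Qed.

End Diagonal.

Theorem mainTheorem1 (K : closedFieldType) (p n : nat)
  (hp : p \in [pchar K]) (hp2 : p != 2%N) (hn : (3 < n)%N)
  (Phi : endo K n -> endo K n)
  (hPhi : is_group_aut_aut0 Phi)
  (htorus : forall lam : 'I_n -> K, (forall i, lam i != 0) ->
      Phi (torus lam) = torus lam) :
  exists2 S : 'M[K]_n, S \in unitmx &
    forall (i : 'I_n) (P : {mpoly K[n]}), elem_ok i P ->
      ecomp (ecomp (linaut S) (Phi (elem i P))) (linaut (invmx S)) = elem i P.
Proof.
have K_infinite : infinite_field K by move=> q /closed_nonrootP.
have [lam lam0 Phi_conj] :=
  Phi_elem_torus_conj K_infinite hPhi htorus (ltnW hn).
exists (diag_mx (\row_k lam k)) => [|i P Pok]; first exact: diag_mx_unit.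
by rewrite invmx_diag // !linaut_diag Phi_conj.
Qed.
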